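(* Let $m,n\ge 1$ be integers, $d=m+n\ge 3$, and let $\Theta$ be a real $n\times m$ matrix. For each integer $p$ with $1\le p\le d-2$ the following hold. If $p\ge m$, then \[(d-p-1)(1+\mathfrak b_{p+1})\ge (d-p)(1+\mathfrak b_p).\] If $p\le m-1$, then \[(d-p-1)(1+\mathfrak b_p)^{-1}\ge (d-p)(1+\mathfrak b_{p+1})^{-1}-n.\]
   Context: Let $\vec e_1,\dots,\vec e_d$ be the standard basis of $\mathbb R^d$ and let $\pmb\ell_1,\dots,\pmb\ell_d$ be the columns of the $d\times d$ matrix $\begin{pmatrix}E_m&-\Theta^{\top}\\ \Theta&E_n\end{pmatrix}$, where $E_k$ is the $k\times k$ identity matrix. For each $q$, the space $\wedge^q(\mathbb R^d)$ is regarded as a Euclidean space with orthonormal basis $\vec e_{i_1}\wedge\dots\wedge\vec e_{i_q}$, $1\le i_1<\dots<i_q\le d$, and $|\cdot|$ denotes the sup-norm of the coordinates in this basis. The lattice $\wedge^p(\mathbb Z^d)$ consists of integer combinations of these basis multivectors. For $\sigma=\{i_1<\dots<i_k\}\subseteq\{1,\dots,d\}$ put $\vec L_\sigma=\pmb\ell_{i_1}\wedge\dots\wedge\pmb\ell_{i_k}$, with $\vec L_\varnothing=1$. Let $\mathcal J_k$ be the set of $k$-element subsets of $\{1,\dots,m\}$. For $1\le p\le d-1$ put $k_0=\max(0,m-p)$. The regular (resp. uniform) $p$-th Diophantine exponent of the second type $\mathfrak b_p$ (resp. $\mathfrak a_p$) of $\Theta$ is the supremum of the real numbers $\gamma$ with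 the following property: there are arbitrarily large $t$ for which (resp. for every sufficiently large $t$) the system \[\max_{\sigma\in\mathcal J_k}|\vec L_\sigma\wedge\vec Z|\le t^{1-(k-k_0)(1+\gamma)},\qquad k=0,\dots,m,\] has a nonzero solution $\vec Z\in\wedge^p(\mathbb Z^d)$. *)

(* Defs.v *)
From HB Require Import structures.
From mathcomp Require Import all_boot all_order all_algebra.
From mathcomp Require Import all_classical all_reals all_analysis.

Set Implicit Arguments.
Unset Strict Implicit.
Unset Printing Implicit Defensive.
Import Order.TTheory GRing.Theory Num.Theory.

Local Open Scope ring_scope.

(* The exterior algebra of R^d, as the space of all families of coordinates on
   the basis of the e_I = e_{i_1} /\ ... /\ e_{i_q}, I = {i_1 < ... < i_q}; the
   empty set indexes the scalars.  The q-th exterior power is the subspace of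
   the families that vanish outside the q-element sets I. *)
Notation multivector R d := {ffun {set 'I_d} -> R}.

Definition mv_one {R : realType} {d : nat} : multivector R d :=
  [ffun I => (I == finset.set0)%:R].

Definition mv_of_vec {R : realType} {d : nat} (v : 'cV[R]_d) : multivector R d :=
  [ffun I => \sum_(i < d | I == [set i]) v i 0].

(* For disjoint I and J, the sorting sign: e_I /\ e_J = wedge_sign I J * e_(I u J),
   with one factor -1 for each pair (i, j) in I x J that is out of order. *)
Definition wedge_sign {R : realType} {d : nat} (I J : {set 'I_d}) : R :=
  (-1) ^+ #|[set ij : 'I_d * 'I_d | [&& ij.1 \in I, ij.2 \in J & (ij.2 < ij.1)%N]]|.

Definition wedge {R : realType} {d : nat} (u v : multivector R d) :
    multivector R d :=
  [ffun K : {set 'I_d} =>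
     \sum_(I : {set 'I_d} | I \subset K)
        wedge_sign I (K :\: I) * u I * v (K :\: I)].

Definition mv_norm {R : realType} {d : nat} (u : multivector R d) : R :=
  \big[Num.max/0]_(I : {set 'I_d}) `|u I|.

Definition int_multivector {R : realType} {d : nat} (p : nat)
    (Z : multivector R d) : Prop :=
  forall I : {set 'I_d}, Z I \is a Num.int /\ (#|I| != p -> Z I = 0).

Section Exponents.
Context {R : realType} {m n : nat} (Theta : 'M[R]_(n, m)).

Definition ell_mx : 'M[R]_(m + n) := block_mx 1%:M (- Theta^T) Theta 1%:M.

(* [enum sigma] lists sigma in increasing order; [lshift n] embeds the first m
   indices into 'I_(m + n). *)
Definition L_sigma (sigma : {set 'I_m}) : multivector R (m + n) :=
  \big[wedge/mv_one]_(i <- enum sigma) mv_of_vec (col (lshift n i) ell_mx).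

(* k_0 = max(0, m - p) is the truncated difference of natural numbers. *)
Definition k0 (p : nat) : nat := (m - p)%N.

Definition system_solvable (p : nat) (gamma t : R) : Prop :=
  exists Z : multivector R (m + n),
    [/\ int_multivector p Z, Z != 0 &
      forall k : nat, (k <= m)%N ->
        \big[Num.max/0]_(sigma : {set 'I_m} | #|sigma| == k)
           mv_norm (wedge (L_sigma sigma) Z)
        <= t `^ (1 - (k%:R - (k0 p)%:R) * (1 + gamma))].

(* The exponent may be +oo, hence the supremum in the extended reals. *)
Definition regular_exponent (p : nat) : \bar R :=
  ereal_sup [set gamma%:E | gamma in
    [set gamma : R | forall T : R, exists2 t : R, T < t &
                                     system_solvable p gamma t]]%classic.

End Exponents.

(* Main.v *)
Require Import Defs.
From HB Require Import structures.
From mathcomp Require Import all_boot all_order all_algebra.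
From mathcomp Require Import all_classical all_reals all_analysis.
From mathcomp Require Import fingroup perm.
From mathcomp Require Import ring lra zify.

Set Implicit Arguments.
Unset Strict Implicit.
Unset Printing Implicit Defensive.
Import Order.TTheory GRing.Theory Num.Theory.
Local Open Scope ring_scope.

(* Write s = t^(1+gamma) and x = 1/(1+gamma).  In the basis of the first m columns
   l_i and of the e_j, j > m, scaled by diag(1/s,...,1/s,1,...,1), the system for
   (p, gamma, t) says, up to a constant, that all the coordinates of Z are at most
   s^(x - min(m,p)): the first minimum of the p-th compound of a lattice of
   determinant s^(-m) is bounded.
   A reduced basis of a lattice has a triangular factor U whose diagonal entries u_i
   satisfy u_i << u_j for i <= j.  A nonzero integer p-vector Z, decomposable or not,
   has image of size >> u_0...u_(p-1), as its coordinate of maximal weight is an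
   integer multiple of the corresponding product of p diagonal entries; while the
   wedge of the first p+1 basis vectors has size << u_0...u_p.  Since
   u_p^(d-p) << u_p...u_(d-1), the first minima mu_p and mu_(p+1) satisfy
   mu_(p+1)^(d-p) << |det| mu_p^(d-p-1), and both inequalities are this one rewritten
   in terms of x. *)

(** * The exterior algebra and the functoriality of compounds *)

Section Wedge.
Import mathcomp.boot.fintype mathcomp.boot.finset.
Context {R : realType} {d : nat}.
Implicit Types (I J K : {set 'I_d}) (u v w : multivector R d) (x y : 'cV[R]_d).
Implicit Types (i j k : 'I_d) (g h : 'M[R]_d).

Local Notation inv_sign i j := (if (j < i)%N then -1 else 1 : R).

(** A product over pairs, unlike a power of -1, splits along disjoint unions in either argument. *)
Lemma wedge_signE I J :
  wedge_sign I J = \prod_(i in I) \prod_(j in J) inv_sign i j.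
Proof.
rewrite pair_big /= /wedge_sign -prodr_const -big_mkcondr /=.
by apply: eq_bigl => -[i j]; rewrite inE /= andbA.
Qed.

Lemma wedge_signUl I J K : [disjoint I & J] ->
  wedge_sign (I :|: J) K = wedge_sign I K * wedge_sign J K :> R.
Proof. by move=> IJ; rewrite !wedge_signE -bigU //; apply: eq_bigl => i; rewrite !inE. Qed.

Lemma wedge_signUr I J K : [disjoint J & K] ->
  wedge_sign I (J :|: K) = wedge_sign I J * wedge_sign I K :> R.
Proof.
move=> JK; rewrite !wedge_signE -big_split /=.
by apply: eq_bigr => i _; rewrite -bigU //; apply: eq_bigl => j; rewrite !inE.
Qed.

Lemma wedge_sign0l I : wedge_sign set0 I = 1 :> R.
Proof. by rewrite wedge_signE big_set0. Qed.

Lemma wedge_sign0r I : wedge_sign I set0 = 1 :> R.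
Proof. by rewrite wedge_signE big1 // => i _; rewrite big_set0. Qed.

Lemma wedge_sign11 i j : wedge_sign [set i] [set j] = inv_sign i j.
Proof. by rewrite wedge_signE !big_set1. Qed.

Lemma wedge_sign1_min i J :
  (forall k, k \in J -> (i < k)%N) -> wedge_sign [set i] J = 1 :> R.
Proof.
move=> iJ; rewrite wedge_signE big_set1 big1 // => k /iJ.
by rewrite ltnNge leq_eqVlt negb_or => /andP[_ /negbTE ->].
Qed.

Lemma wedge_sign_id I J : `|wedge_sign I J| = 1 :> R.
Proof. by rewrite /wedge_sign normrX normrN1 expr1n. Qed.

Lemma setU_setD_id I J : I \subset J -> I :|: J :\: I = J.
Proof.
move/subsetP=> IJ; apply/setP => k; rewrite !inE.
by case: (boolP (k \in I)) => // /IJ ->.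
Qed.

Lemma wedgeA : associative (wedge : multivector R d -> _).
Proof.
move=> u v w; apply/ffunP => K; rewrite !ffunE.
(* Both sides are sums over chains of sets I, J, K, each inside the next, with [I], [J :\: I] and
   [K :\: J] indexing the three factors. The signs then split over the same three pairs of
   blocks. *)
transitivity (\sum_(I : {set 'I_d} | I \subset K)
   \sum_(J : {set 'I_d} | (J \subset K) && (I \subset J))
    wedge_sign I (K :\: I) * u I *
      (wedge_sign (J :\: I) (K :\: J) * v (J :\: I) * w (K :\: J))).
  apply: eq_bigr => I IK; rewrite ffunE mulr_sumr.
  rewrite (reindex_onto (fun J => J :\: I) (fun J => I :|: J)) /=; last first.
    move=> J JKI; rewrite setDUl setDv set0U.
    by apply/setDidPl; move: JKI; rewrite subsetD => /andP[].
  apply: eq_big => J.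
    apply/andP/andP => [[JK /eqP <-]|[JK IJ]].
      split; last exact: subsetUl.
      rewrite subUset IK /=; exact: subset_trans JK (subsetDl _ _).
    split; first exact: setSD.
    by rewrite setU_setD_id.
  move=> /andP[_ /eqP IJ]; congr (_ * (_ * _ * w _)).
    congr wedge_sign.
    by rewrite setDDl IJ.
  by rewrite setDDl IJ.
rewrite (exchange_big_dep (fun J => J \subset K)) /=; last by move=> ? ? _ /andP[].
apply: eq_bigr => J JK; rewrite ffunE mulr_sumr mulr_suml.
apply: eq_big => I.
  apply/andP/idP => [[_ /andP[]]//|IJ]; split; last by rewrite JK.
  exact: subset_trans JK.
move=> /andP[IK /andP[_ IJ]].
have dIJ : [disjoint I & J :\: I] by rewrite disjoint_sym disjoints_subset subsetDr.
have -> : K :\: I = (J :\: I) :|: (K :\: J).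
  apply/setP => k; rewrite !inE.
  case: (boolP (k \in I)) => [/(subsetP IJ) -> //|_] /=.
  by case: (boolP (k \in J)) => [/(subsetP JK) ->|].
rewrite wedge_signUr; last first.
  by rewrite disjoint_sym disjoints_subset; apply/subsetP => k;
    rewrite !inE; case: (k \in J); rewrite //= andbF.
have -> : wedge_sign J (K :\: J) = wedge_sign I (K :\: J) * wedge_sign (J :\: I) (K :\: J) :> R.
  rewrite -wedge_signUl //; congr wedge_sign.
  by rewrite setU_setD_id.
ring.
Qed.

Lemma wedgeE u v K : wedge u v K =
  \sum_(I : {set 'I_d} | I \subset K) wedge_sign I (K :\: I) * u I * v (K :\: I).
Proof. by rewrite ffunE. Qed.

Lemma wedge1l u : wedge mv_one u = u.
Proof.
apply/ffunP => K; rewrite ffunE (bigD1 set0) ?sub0set //=.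
rewrite ffunE eqxx wedge_sign0l setD0 !mul1r big1 ?addr0 // => I /andP[_ /negbTE I0].
by rewrite ffunE I0 mulr0 mul0r.
Qed.

Lemma wedge_vecE x u K : wedge (mv_of_vec x) u K =
  \sum_(i in K) wedge_sign [set i] (K :\ i) * x i 0 * u (K :\ i).
Proof.
rewrite ffunE.
under eq_bigr => I _ do rewrite ffunE mulr_sumr mulr_suml.
rewrite (exchange_big_dep predT) //= [RHS]big_mkcond /=; apply: eq_bigr => i _.
case: ifP => iK.
  rewrite (big_pred1 [set i]) // => I.
  apply/andP/eqP => [[_ /eqP]//|->]; by rewrite sub1set iK.
rewrite big_pred0 // => I; apply/negbTE/negP => /andP[+ /eqP IE].
by rewrite IE sub1set iK.
Qed.

(** Removing i then j from K is matched with removing j then i; only the sign of the pair (i, j)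
    changes. The common right factor [u] lets the rule act inside longer products. *)
Lemma wedge_vecC x y u :
  wedge (mv_of_vec x) (wedge (mv_of_vec y) u)
  = - wedge (mv_of_vec y) (wedge (mv_of_vec x) u).
Proof.
apply/ffunP => K; rewrite wedge_vecE [RHS]ffunE wedge_vecE.
under eq_bigr => i _ do rewrite wedge_vecE mulr_sumr.
under [in RHS]eq_bigr => i _ do rewrite wedge_vecE mulr_sumr.
rewrite -sumrN.
under [RHS]eq_bigr => i _ do rewrite -sumrN.
rewrite (exchange_big_dep (mem K)) /=; last by move=> i j _; rewrite inE => /andP[].
apply: eq_bigr => j jK; apply: eq_big => [i|i /andP[iK jKi]].
  by rewrite !inE jK andbT eq_sym andbC.
have nij : i != j by move: jKi; rewrite !inE eq_sym => /andP[].
have Ej : K :\ j = [set i] :|: (K :\ i) :\ j.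
  apply/setP => k; rewrite !inE; by case: (eqVneq k i) => [->|] //=; rewrite nij iK.
have Ei : K :\ i = [set j] :|: (K :\ i) :\ j.
  apply/setP => k; rewrite !inE; case: (eqVneq k j) => [->|] //=.
  by rewrite eq_sym nij jK.
have Eij : (K :\ j) :\ i = (K :\ i) :\ j.
  by apply/setP => k; rewrite !inE; case: (k == j); rewrite //= andbF.
have dj : [disjoint [set j] & (K :\ i) :\ j] by rewrite disjoints1 !inE eqxx.
have di : [disjoint [set i] & (K :\ i) :\ j] by rewrite disjoints1 !inE eqxx andbF.
rewrite Eij Ej {1}Ei !wedge_signUr //.
rewrite !wedge_sign11.
have -> : inv_sign i j = - inv_sign j i.
  by case: ltngtP => [||/val_inj ij] //; rewrite ?opprK //; rewrite ij eqxx in nij.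
ring.
Qed.

Lemma wedge_vec_id x u : wedge (mv_of_vec x) (wedge (mv_of_vec x) u) = 0.
Proof.
have := wedge_vecC x x u; move=> /ffunP e; apply/ffunP => K.
by move: (e K); rewrite !ffunE; set a := \sum_(_ | _) _; lra.
Qed.

Definition fold_vec (g : 'M[R]_d) (l : seq 'I_d) u : multivector R d :=
  foldr (fun i w => wedge (mv_of_vec (col i g)) w) u l.

(** The indices are enumerated in increasing order, so for K of the same size as J the coordinate at
    K is the minor of [g] with rows K and columns J. *)
Definition ext_basis g J : multivector R d :=
  \big[wedge/mv_one]_(i < d | i \in J) mv_of_vec (col i g).

(* The compound (exterior power) of g. *)
Definition ext_map g u : multivector R d :=
  [ffun K => \sum_J u J * ext_basis g J K].

Lemma ext_mapE g u K : ext_map g u K = \sum_J u J * ext_basis g J K.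
Proof. by rewrite ffunE. Qed.

Lemma ext_basis0 g : ext_basis g set0 = mv_one.
Proof. by rewrite /ext_basis big_pred0 // => i; rewrite inE. Qed.

Lemma ext_basis_min g j J : (forall k, k \in J -> (j < k)%N) ->
  ext_basis g (j |: J) = wedge (mv_of_vec (col j g)) (ext_basis g J).
Proof.
move=> jJ; rewrite /ext_basis.
have : sorted ltn [seq val i | i <- index_enum 'I_d].
  by rewrite /index_enum -enumT val_enum_ord iota_ltn_sorted.
have : j \in index_enum 'I_d by rewrite mem_index_enum.
elim: (index_enum 'I_d) => [//|a l IH] /=.
rewrite inE !big_cons !inE.
have [ea _ pl|naj /= jl /[dup] + /path_sorted sl] := eqVneq a j.
  subst a; have -> : j \in J = false by apply/negP => /jJ; rewrite ltnn.
  rewrite /=; congr wedge; rewrite big_seq_cond [RHS]big_seq_cond.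
  apply: eq_bigl => i; rewrite !inE; case: eqVneq => [->|] //.
  move: pl; rewrite (path_sortedE ltn_trans) => /andP[/allP al _].
  by case: (boolP (j \in l)) => // /(map_f val)/al; rewrite ltnn.
rewrite (path_sortedE ltn_trans) => /andP[/allP al _].
have aj : (a < j)%N by apply: al; apply: map_f.
have -> : a \in J = false by apply/negP => /jJ; rewrite ltnNge ltnW.
by rewrite /=; apply: IH.
Qed.

(* Removing the smallest element keeps all the signs equal to 1. *)
Lemma set_min_ind (P : {set 'I_d} -> Prop) : P set0 ->
  (forall j J, (forall k, k \in J -> (j < k)%N) -> P J -> P (j |: J)) ->
  forall J, P J.
Proof.
move=> P0 PS J; move: {2}#|J| (leqnn #|J|) => N.
elim: N J => [|N IH] J.
  by rewrite leqn0 cards_eq0 => /eqP ->.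
have [->//|[j0 j0J]] := set_0Vmem J; move=> cJ.
have [j jJ jmin] := arg_minnP (fun i : 'I_d => i : nat) j0J.
rewrite -(setD1K jJ); apply: PS.
  move=> k; rewrite !inE => /andP[kj kJ].
  by rewrite ltn_neqAle jmin // andbT eq_sym.
by apply: IH; move: cJ; rewrite (cardsD1 j J) (jJ : j \in J).
Qed.

Lemma wedgeZr a u v K : wedge u [ffun I => a * v I] K = a * wedge u v K.
Proof. by rewrite !ffunE mulr_sumr; apply: eq_bigr => I _; rewrite ffunE; ring. Qed.

Lemma wedge_vec0 x : wedge (mv_of_vec x) 0 = 0.
Proof.
by apply/ffunP => K; rewrite wedge_vecE ffunE big1 // => i _; rewrite ffunE mulr0.
Qed.

(** The vector of index i is moved past the smaller elements of J one at a time; each swap gives one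
    of the factors -1 counted by [wedge_sign], and meeting itself gives 0. *)
Lemma wedge_ext_basis g i J : wedge (mv_of_vec (col i g)) (ext_basis g J) =
  if i \in J then 0 else [ffun K => wedge_sign [set i] J * ext_basis g (i |: J) K].
Proof.
elim/set_min_ind: J => [|j J jJ IH].
  rewrite inE -ext_basis_min; last by move=> k; rewrite inE.
  by apply/ffunP => K; rewrite ffunE wedge_sign0r mul1r.
rewrite (ext_basis_min _ jJ) !inE.
have [->|nij] /= := eqVneq i j; first exact: wedge_vec_id.
have [ij|ji|/val_inj] := ltngtP i j; last by move/eqP; rewrite (negbTE nij).
  have iJ k : k \in j |: J -> (i < k)%N.
    by rewrite !inE => /predU1P[->//|/jJ]; apply: ltn_trans.
  have -> : i \in J = false by apply/negP => /jJ; rewrite ltnNge ltnW.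
  rewrite -(ext_basis_min _ jJ) -(ext_basis_min _ iJ).
  by apply/ffunP => K; rewrite ffunE wedge_sign1_min // mul1r.
rewrite wedge_vecC IH; case: ifP => iJ; first by rewrite wedge_vec0 oppr0.
apply/ffunP => K; rewrite [LHS]ffunE wedgeZr [RHS]ffunE -ext_basis_min; last first.
  by move=> k; rewrite !inE => /predU1P[->//|]; apply: jJ.
have -> : i |: (j |: J) = j |: (i |: J) by rewrite !setUA [[set i] :|: _]setUC.
rewrite wedge_signUr; last by rewrite disjoints1; apply/negP => /jJ; rewrite ltnn.
by rewrite wedge_sign11 ji; ring.
Qed.

Lemma mv_of_vec_mulmx g x K :
  mv_of_vec (g *m x) K = \sum_i x i 0 * mv_of_vec (col i g) K.
Proof.
rewrite ffunE; under [RHS]eq_bigr => i _ do rewrite ffunE mulr_sumr.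
rewrite (exchange_big_dep (fun j => K == [set j])) //=; apply: eq_bigr => j Kj.
rewrite mxE; apply: eq_big => [i|i _]; first by rewrite Kj.
by rewrite mxE mulrC.
Qed.

(** After expanding [x], the sets J containing i contribute nothing by [wedge_ext_basis], and the
    others correspond to the sets [i |: J] on the left-hand side. *)
Lemma ext_map_wedge_vec g x u :
  ext_map g (wedge (mv_of_vec x) u) = wedge (mv_of_vec (g *m x)) (ext_map g u).
Proof.
apply/ffunP => K; rewrite ffunE.
under eq_bigr => I _ do rewrite wedge_vecE mulr_suml.
rewrite (exchange_big_dep predT) //=.
transitivity (\sum_i \sum_J x i 0 * u J *
    wedge (mv_of_vec (col i g)) (ext_basis g J) K).
  apply: eq_bigr => i _; rewrite [RHS](bigID (fun J : {set 'I_d} => i \in J)) /=.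
  rewrite [X in _ = X + _]big1 ?add0r; last first.
    by move=> J iJ; rewrite wedge_ext_basis iJ ffunE mulr0.
  rewrite (reindex_onto (fun J => i |: J) (fun J => J :\ i)) /=; last first.
    by move=> J; apply: setD1K.
  apply: eq_big => J.
    rewrite setU11 /=; case: (boolP (i \in J)) => iJ; last by rewrite setU1K ?eqxx.
    by apply/negP => /eqP E; move: iJ; rewrite -E !inE eqxx.
  case/andP=> _ /eqP E; have niJ : i \notin J by rewrite -E !inE eqxx.
  by rewrite E wedge_ext_basis (negbTE niJ) ffunE; ring.
rewrite exchange_big /= wedgeE; under [RHS]eq_bigr => I _ do rewrite ext_mapE mulr_sumr.
rewrite [RHS]exchange_big /=; apply: eq_bigr => J _.
under eq_bigr => i _ do rewrite wedgeE mulr_sumr.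
rewrite exchange_big /=; apply: eq_bigr => I _.
rewrite mv_of_vec_mulmx mulr_sumr mulr_suml; apply: eq_bigr => i _; ring.
Qed.

Lemma ext_map1 g : ext_map g mv_one = mv_one.
Proof.
apply/ffunP => K; rewrite ffunE (bigD1 set0) //= ffunE eqxx mul1r ext_basis0.
by rewrite big1 ?addr0 // => J /negbTE J0; rewrite ffunE J0 mul0r.
Qed.

Lemma col_mulmx g h i : col i (g *m h) = g *m col i h.
Proof. by rewrite !colE mulmxA. Qed.

Lemma ext_map_basis g h J : ext_map g (ext_basis h J) = ext_basis (g *m h) J.
Proof.
rewrite /ext_basis; elim: (index_enum 'I_d) => [|a l IH].
  by rewrite !big_nil ext_map1.
by rewrite !big_cons; case: ifP => // _; rewrite ext_map_wedge_vec IH col_mulmx.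
Qed.

(** This is the Cauchy-Binet formula, obtained without determinants from the action on basis
    multivectors. *)
Lemma ext_map_comp g h u : ext_map g (ext_map h u) = ext_map (g *m h) u.
Proof.
apply/ffunP => K; rewrite !ffunE.
under eq_bigr => I _ do rewrite ffunE mulr_suml.
rewrite exchange_big /=; apply: eq_bigr => J _.
rewrite -ext_map_basis ffunE mulr_sumr; apply: eq_bigr => I _; ring.
Qed.

End Wedge.

(** * Size, integrality and triangularity of compounds *)

Section Estimates.
Import mathcomp.boot.fintype mathcomp.boot.finset.
Context {R : realType} {d : nat}.
Implicit Types (I J K : {set 'I_d}) (u v w : multivector R d) (x y : 'cV[R]_d).
Implicit Types (i j k : 'I_d) (g h : 'M[R]_d) (l : seq 'I_d) (M N : R).

Lemma wedge_vec_bound x u M N : 0 <= M -> (forall i, `|x i 0| <= M) ->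
  (forall K, `|u K| <= N) -> forall K, `|wedge (mv_of_vec x) u K| <= d%:R * M * N.
Proof.
move=> M0 xM uN K; have N0 : 0 <= N by apply: le_trans (uN set0).
rewrite wedge_vecE; apply: le_trans (ler_norm_sum _ _ _) _.
apply: le_trans (_ : \sum_(i in K) M * N <= _).
  apply: ler_sum => i _; rewrite !normrM wedge_sign_id mul1r.
  exact: ler_pM.
rewrite sumr_const -[_ *+ _]mulr_natl -mulrA ler_wpM2r ?mulr_ge0 // ler_nat.
by rewrite -[leqRHS](card_ord d) max_card.
Qed.

Lemma ext_basis_bound g M : 0 <= M -> (forall i j, `|g i j| <= M) ->
  forall J K, `|ext_basis g J K| <= (1 + d%:R * M) ^+ d.
Proof.
move=> M0 gM J; have -> : (1 + d%:R * M) ^+ d = (1 + d%:R * M) ^+ size (index_enum 'I_d).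
  by rewrite /index_enum -enumT size_enum_ord.
have dM : 0 <= d%:R * M by rewrite mulr_ge0.
rewrite /ext_basis; elim: (index_enum 'I_d) => [|a l IH] K.
  by rewrite big_nil expr0 ffunE normr_nat lern1 leq_b1.
rewrite big_cons /=; case: ifP => _.
  have := wedge_vec_bound M0 (fun i => _ : `|col a g i 0| <= M) IH.
  move=> /(_ _ K) h; apply: (le_trans (h _)); first by move=> i; rewrite mxE.
  by rewrite exprS ler_wpM2r ?exprn_ge0 ?addr_ge0 ?lerDr.
apply: le_trans (IH K) _; rewrite exprS ler_peMl ?lerDl //.
by rewrite exprn_ge0 ?addr_ge0.
Qed.

Lemma ext_map_bound g u M N : 0 <= M -> (forall i j, `|g i j| <= M) ->
  (forall K, `|u K| <= N) ->
  forall K, `|ext_map g u K| <= #|{set 'I_d}|%:R * (1 + d%:R * M) ^+ d * N.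
Proof.
move=> M0 gM uN K; rewrite ext_mapE; apply: le_trans (ler_norm_sum _ _ _) _.
rewrite -mulrA mulr_natl -sumr_const; apply: ler_sum => J _.
rewrite normrM mulrC; apply: ler_pM => //; exact: ext_basis_bound.
Qed.

Lemma ext_basis_grade g J K : #|K| != #|J| -> ext_basis g J K = 0.
Proof.
move: J K; elim/(@set_min_ind d) => [|j J jJ IH] K.
  by rewrite ext_basis0 ffunE cards0 cards_eq0 => /negbTE ->.
rewrite ext_basis_min // wedge_vecE cardsU1.
have -> : j \notin J by apply/negP => /jJ; rewrite ltnn.
move=> cK; rewrite big1 // => i iK; rewrite IH ?mulr0 //.
by move: cK; rewrite (cardsD1 i K) iK; apply: contra => /eqP ->.
Qed.

Lemma ext_map_grade g u p : (forall I, #|I| != p -> u I = 0) ->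
  forall I, #|I| != p -> ext_map g u I = 0.
Proof.
move=> u0 I Ip; rewrite ext_mapE big1 // => J _.
have [Jp|/u0 ->] := eqVneq #|J| p; last by rewrite mul0r.
by rewrite ext_basis_grade ?mulr0 // Jp.
Qed.

Lemma ext_basis_int g J K : (forall i j, g i j \is a Num.int) ->
  ext_basis g J K \is a Num.int.
Proof.
move=> gi; move: J K; elim/(@set_min_ind d) => [|j J jJ IH] K.
  by rewrite ext_basis0 ffunE; case: (_ == _).
rewrite ext_basis_min // wedge_vecE; apply: rpred_sum => i _.
apply: rpredM (IH _); apply: rpredM; last by rewrite mxE.
by rewrite /wedge_sign rpredX // rpredN rpred1.
Qed.

Lemma ext_basis_int_multivector g J : (forall i j, g i j \is a Num.int) ->
  int_multivector #|J| (ext_basis g J).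
Proof.
move=> gi I; split; first exact: ext_basis_int.
exact: ext_basis_grade.
Qed.

Lemma ext_map_int g u p : (forall i j, g i j \is a Num.int) ->
  int_multivector p u -> int_multivector p (ext_map g u).
Proof.
move=> gi ui I; split; last by apply: ext_map_grade => J /(proj2 (ui J)).
rewrite ext_mapE; apply: rpred_sum => J _; apply: rpredM; first exact: (proj1 (ui J)).
exact: ext_basis_int.
Qed.

Definition weight (f : 'I_d -> nat) J := (\sum_(i in J) f i)%N.

(* The weight f orders the subsets; [f] = [val] serves for upper triangular matrices
   and an indicator function for diagonal ones. *)
Lemma ext_basis_triangular g (f : 'I_d -> nat) :
  (forall i j, g i j != 0 -> i = j \/ (f i < f j)%N) ->
  forall J K, (weight f J <= weight f K)%N ->
  ext_basis g J K = (K == J)%:R * \prod_(j in J) g j j.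
Proof.
move=> gt; elim/(@set_min_ind d) => [|j J jJ IH] K.
  by rewrite ext_basis0 ffunE big_set0 mulr1.
have jNJ : j \notin J by apply/negP => /jJ; rewrite ltnn.
rewrite ext_basis_min // wedge_vecE /weight !big_setU1 // => wJ.
(* An off-diagonal entry requires f i < f j, which makes [K :\ i] strictly heavier than J; the
   induction hypothesis then annihilates the term. *)
have z i : i \in K -> i != j -> col j g i 0 * ext_basis g J (K :\ i) = 0.
  rewrite mxE => iK ij; have [->|/gt[/eqP|fij]] := eqVneq (g i j) 0.
  - by rewrite mul0r.
  - by rewrite (negbTE ij).
  move: wJ; rewrite (big_setD1 i iK) /= => wJ.
  rewrite IH; last by rewrite -(leq_add2l (f i)) (leq_trans _ wJ) // leq_add2r ltnW.
  case: eqVneq => [E|]; last by rewrite mul0r mulr0.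
  by move: wJ; rewrite E leq_add2r leqNgt fij.
case: (boolP (j \in K)) => jK; last first.
  rewrite big1 => [|i iK]; last first.
    by rewrite -mulrA z ?mulr0 //; apply: contraNneq jK => <-.
  case: eqVneq jK => [->|_ _]; last by rewrite mul0r.
  by rewrite setU11.
rewrite (bigD1 j) //= big1 ?addr0 => [|i /andP[iK ij]]; last first.
  by rewrite -mulrA z ?mulr0.
rewrite mxE IH; last by move: wJ; rewrite (big_setD1 j jK) /= leq_add2l.
have -> : (K :\ j == J) = (K == j |: J).
  by apply/eqP/eqP => [<-|->]; rewrite ?setD1K ?setU1K.
case: eqVneq => [->|_]; last by rewrite !mul0r mulr0.
by rewrite setU1K // wedge_sign1_min // !mul1r.
Qed.

(** At an index set at least as heavy as the whole support only the diagonal term survives. This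
    gives lower bounds for images of multivectors that may be indecomposable. *)
Lemma ext_map_triangular g (f : 'I_d -> nat) u I :
  (forall i j, g i j != 0 -> i = j \/ (f i < f j)%N) ->
  (forall J, u J != 0 -> (weight f J <= weight f I)%N) ->
  ext_map g u I = u I * \prod_(i in I) g i i.
Proof.
move=> gt uw; rewrite ext_mapE (bigD1 I) //= (ext_basis_triangular gt) // eqxx mul1r.
rewrite [X in _ + X]big1 ?addr0 // => J JI; have [->|/uw uJ] := eqVneq (u J) 0.
  by rewrite mul0r.
by rewrite (ext_basis_triangular gt) // eq_sym (negbTE JI) mul0r mulr0.
Qed.

Lemma ext_map_diag g u K : (forall i j, i != j -> g i j = 0) ->
  ext_map g u K = u K * \prod_(i in K) g i i.
Proof.
(* This weight of J is the size of its intersection with K, which is largest at J = K, so every [u]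
   qualifies. *)
move=> gd; apply: (@ext_map_triangular _ (fun i => i \in K)) => [i j|J _].
  by have [->|/gd ->] := eqVneq i j; [left|rewrite eqxx].
rewrite /weight big_mkcond [leqRHS]big_mkcond /=; apply: leq_sum => i _.
by case: (i \in J); case: (i \in K).
Qed.

Lemma ext_map_id u : ext_map 1%:M u = u.
Proof.
apply/ffunP => K; rewrite ext_map_diag; last by move=> i j /negbTE ij; rewrite mxE ij.
by rewrite big1 ?mulr1 // => i _; rewrite mxE eqxx.
Qed.

Lemma ext_map_inj g : g \in unitmx -> injective (ext_map g).
Proof.
move=> gu u v /(congr1 (ext_map (invmx g))).
by rewrite !ext_map_comp mulVmx // !ext_map_id.
Qed.

Lemma ext_map_eq0 g u : g \in unitmx -> (ext_map g u == 0) = (u == 0).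
Proof.
move=> gu; have e0 : ext_map g 0 = 0.
  by apply/ffunP => K; rewrite ext_mapE big1 ?ffunE // => J _; rewrite ffunE mul0r.
by rewrite -[in LHS]e0 (inj_eq (ext_map_inj gu)).
Qed.

Lemma ext_map_fold_vec g h l u :
  ext_map g (fold_vec h l u) = fold_vec (g *m h) l (ext_map g u).
Proof.
by elim: l => [//|a l IH] /=; rewrite ext_map_wedge_vec IH col_mulmx.
Qed.

(** Wedging with standard basis vectors only relabels coordinates up to sign, and the absolute
    values hide the sign. *)
Lemma fold_vec_id l u K : uniq l -> `|fold_vec 1%:M l u K| =
  if [set i in l] \subset K then `|u (K :\: [set i in l])| else 0.
Proof.
elim: l K => [|a l IH] K /=; first by rewrite set_nil sub0set setD0.
case/andP=> al ul; rewrite set_cons subUset sub1set wedge_vecE.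
case: (boolP (a \in K)) => aK /=.
  rewrite (bigD1 a) //= big1 ?addr0 => [|i /andP[_ ia]]; last first.
    by rewrite !mxE (negbTE ia) mulr0 mul0r.
  rewrite !mxE eqxx mulr1 normrM wedge_sign_id mul1r IH //.
  by rewrite subsetD1 inE al andbT setDDl.
rewrite big1 ?normr0 // => i iK; rewrite !mxE.
case: eqVneq => [ia|]; last by rewrite mulr0 mul0r.
by rewrite -ia iK in aK.
Qed.

End Estimates.

(** * Reduction of lattice bases *)

Section Reduction.
Context {R : realType}.

Local Notation toR := (map_mx (intr : int -> R)).

Definition sup_norm d (x : 'cV[R]_d) : R := \big[Num.max/0]_i `|x i 0|.

Lemma le_sup_norm d (x : 'cV[R]_d) i : `|x i 0| <= sup_norm x.
Proof. by rewrite /sup_norm (le_bigmax _ (fun i => `|x i 0|)). Qed.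

Lemma sup_norm_le d (x : 'cV[R]_d) N :
  0 <= N -> (forall i, `|x i 0| <= N) -> sup_norm x <= N.
Proof. by move=> N0 xN; apply: bigmax_le. Qed.

Lemma sup_norm_ge0 d (x : 'cV[R]_d) : 0 <= sup_norm x.
Proof. exact: bigmax_ge_id. Qed.

Lemma sup_norm_int_ge1 d (z : 'cV[int]_d) : z != 0 -> 1 <= sup_norm (toR z).
Proof.
case/cV0Pn => i zi; apply: le_trans (le_sup_norm _ i); rewrite mxE.
by rewrite -intr_norm ler1z -gtz0_ge1 normr_gt0.
Qed.

Lemma sup_norm_mulmx d (A : 'M[R]_d) x :
  sup_norm (A *m x) <= (\sum_i \sum_j `|A i j|) * sup_norm x.
Proof.
have S0 : 0 <= \sum_i \sum_j `|A i j| by do 2!apply: sumr_ge0 => ? _.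
apply: sup_norm_le => [|i]; first by rewrite mulr_ge0 ?sup_norm_ge0.
rewrite mxE; apply: le_trans (ler_norm_sum _ _ _) _.
apply: le_trans (_ : (\sum_j `|A i j|) * sup_norm x <= _).
  by rewrite mulr_suml; apply: ler_sum => j _; rewrite normrM ler_wpM2l // le_sup_norm.
rewrite ler_wpM2r ?sup_norm_ge0 // [leRHS](bigD1 i) //= lerDl.
by do 2!apply: sumr_ge0 => ? _.
Qed.

(** Norms of nonzero lattice vectors are bounded below through the inverse of [g], so their infimum
    is positive and is approached within a factor 3/2; the factor avoids showing that a minimum is
    attained. *)
Lemma almost_shortest d (g : 'M[R]_d.+1) : g \in unitmx ->
  exists2 z : 'cV[int]_d.+1, z != 0 & forall z', z' != 0 ->
    sup_norm (g *m toR z) <= 3 / 2 * sup_norm (g *m toR z').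
Proof.
move=> gu; set C := 1 + \sum_i \sum_j `|invmx g i j|.
have C0 : 0 < C.
  by rewrite ltr_wpDr //; do 2!apply: sumr_ge0 => ? _.
have lbC z : z != 0 -> C^-1 <= sup_norm (g *m toR z).
  move=> /sup_norm_int_ge1 h; rewrite -[toR z](mulKmx gu) in h.
  rewrite -(ler_pM2l C0) mulfV ?gt_eqF //; apply: le_trans h (le_trans (sup_norm_mulmx _ _) _).
  by rewrite ler_wpM2r ?sup_norm_ge0 // /C lerDr.
pose E := [set r | exists2 z : 'cV[int]_d.+1, z != 0 & r = sup_norm (g *m toR z)]%classic.
have hE : has_inf E.
  split; last by exists C^-1 => _ [z z0 ->]; exact: lbC.
  exists (sup_norm (g *m toR (delta_mx 0 0))); exists (delta_mx 0 0) => //.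
  by apply/cV0Pn; exists 0; rewrite mxE.
have iE : 0 < inf E.
  apply: lt_le_trans (_ : C^-1 <= _); first by rewrite invr_gt0.
  by apply: lb_le_inf; [case: hE|move=> _ [z z0 ->]; exact: lbC].
have [_ [z z0 ->] zE] := inf_adherent (divr_gt0 iE (ltr0Sn R 1)) hE.
exists z => // z' z'0; have : inf E <= sup_norm (g *m toR z').
  by apply: ge_inf; [case: hE|exists z'].
move: zE; set a := sup_norm _; set b := sup_norm _; lra.
Qed.

(** The Smith normal form of a single column has only its top entry, so [z] is a multiple of a
    vector that extends to a basis. *)
Lemma col_unimodular d (z : 'cV[int]_d.+1) :
  exists2 T : 'M[int]_d.+1, T \in unitmx & exists k, z = k *: col 0 T.
Proof.
have [L uL [Q _ [s _ E]]] := int_Smith_normal_form z.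
exists L => //; exists (s`_0 * Q 0 0).
rewrite E [Q]mx11_scalar mul_mx_scalar.
apply/matrixP => i j; rewrite !mxE (bigD1 0) //= big1 ?addr0 => [|k k0].
  by rewrite !mxE (ord1 j) /= !mulr1n; ring.
rewrite mxE (ord1 j) /=; case: eqP => [kE|_]; last by rewrite mulr0.
by case/eqP: k0; apply/val_inj.
Qed.

Lemma round_half (x : R) : exists a : int, `|x - a%:~R| <= 1 / 2.
Proof.
exists (Num.floor (x + 1 / 2)).
have /andP[] := floor_itv (x + 1 / 2).
by rewrite intrD ler_norml; lra.
Qed.

(* Hermite reduction for the sup-norm: Gaussian elimination with the largest pivot,
   which has entries of size at most 1, replaces the orthogonal projection along an
   almost shortest vector.  The last clause is the induction invariant. *)
Lemma basis_reduction d : exists2 C : R, 1 <= C & forall g : 'M[R]_d, g \in unitmx ->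
  exists (T : 'M[int]_d) (K L U : 'M[R]_d),
  [/\ T \in unitmx, K *m L = 1%:M, g *m toR T = K *m U,
      (forall i j, `|K i j| <= C) & (forall i j, `|L i j| <= C)] /\
  [/\ forall i j : 'I_d, (j < i)%N -> U i j = 0,
      forall i j : 'I_d, (i <= j)%N -> `|U i i| <= C * `|U j j| &
      forall i : 'I_d, i = 0%N :> nat -> exists2 z, z != 0 & sup_norm (g *m toR z) <= `|U i i|].
Proof.
elim: d => [|d [C C1 IH]].
  exists 1 => // g gu; exists 1%:M, 1%:M, 1%:M, 1%:M.
  by split; split; rewrite ?unitmx1 ?mulmx1 //; (try by case) => //; apply/matrixP => -[].
have C0 : 0 <= C by apply: le_trans C1.
(* The 6 is the cost of comparing the new pivot with the next one, and d + 1 absorbs the sum of d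
   terms in the product of [L'] and [c]. *)
exists (6 * d.+1%:R * C) => [|g gu].
  have : 1 <= d.+1%:R :> R by rewrite ler1n.
  by move: C1; nra.
have C1' : C <= 6 * d.+1%:R * C.
  by rewrite ler_peMl // ; have : 1 <= d.+1%:R :> R by [rewrite ler1n]; lra.
have [z0 z00 z0min] := almost_shortest gu.
have [T1 uT1 [k zk]] := col_unimodular z0.
set b := g *m toR (col 0 T1).
have z1 : col 0 T1 != 0 by apply: contraNneq z00 => E; rewrite zk E scaler0.
(* The image of [z0] is a nonzero integer multiple of [b], hence at least as long. *)
have bmin z' : z' != 0 -> sup_norm b <= 3 / 2 * sup_norm (g *m toR z').
  move=> z'0; apply: le_trans (z0min _ z'0).
  apply: sup_norm_le (sup_norm_ge0 _) _ => i; apply: le_trans (le_sup_norm _ i).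
  have -> : g *m toR z0 = k%:~R *: b.
    by rewrite zk map_mxZ -scalemxAr.
  rewrite [X in _ <= `|X|]mxE normrM ler_peMl // -intr_norm ler1z -gtz0_ge1 normr_gt0.
  by apply: contraNneq z00 => E; rewrite zk E scale0r.
(* The largest coordinate of [b] becomes the pivot, so that the multipliers [c] have absolute value
   at most 1. *)
pose i0 := [arg max_(i > 0) `|b i 0|]%O.
have bi0 i : `|b i 0| <= `|b i0 0|.
  by rewrite /i0; case: arg_maxP => //= j _; apply.
have b0 : b i0 0 != 0.
  have : b != 0.
    apply: contra z1 => /eqP E; have : toR (col 0 T1) = 0.
      by rewrite -[LHS](mulKmx gu) -/b E mulmx0.
    by move/matrixP => Z; apply/eqP/matrixP => i j; move: (Z i j);
      rewrite !mxE => /eqP; rewrite intr_eq0 => /eqP.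
  case/cV0Pn=> i bi; rewrite -normr_gt0; apply: lt_le_trans (bi0 i); by rewrite normr_gt0.
set be := b i0 0 in bi0 b0.
pose P : 'M[R]_(1 + d) := tperm_mx 0 i0.
have PP : P *m P = 1%:M by rewrite /P -perm_mxM tperm2 perm_mx1.
pose M : 'M[R]_(1 + d) := P *m (g *m toR T1).
have M0 i : M i 0 = b (tperm 0 i0 i) 0.
  by rewrite /M /P -xrowE mxE /b !mxE; apply: eq_bigr => j _; rewrite !mxE.
have uM : M \in unitmx.
  rewrite !unitmx_mul gu (mulmx1_unit PP).1 /=.
  by rewrite unitmxE det_map_mx; apply: rmorph_unit; rewrite -unitmxE.
have Mul : ulsubmx M = be%:M.
  by rewrite [ulsubmx M]mx11_scalar mxE mxE; congr (_%:M);
    rewrite -[RHS]/(b i0 0) -(tpermL 0 i0) -M0; congr (M _ _); apply/val_inj.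
(* The Schur complement [g'] generates the lattice projected along [b]; the induction hypothesis is
   applied to it. *)
pose r := ursubmx M; pose c := be^-1 *: dlsubmx M; pose g' := drsubmx M - c *m r.
have c1 i j : `|c i j| <= 1.
  rewrite mxE normrM normfV mulrC ler_pdivrMr ?normr_gt0 // mul1r mxE mxE (ord1 j).
  suff -> : M (rshift 1 i) (lshift d 0) = b (tperm 0 i0 (rshift 1 i)) 0 by apply: bi0.
  by rewrite -M0; congr (M _ _); apply/val_inj.
have ME : M = block_mx 1%:M 0 c 1%:M *m block_mx be%:M r 0 g'.
  rewrite mulmx_block !mul1mx !mul0mx ?mulmx0 !addr0 mul_mx_scalar scalerA divff // scale1r.
  by rewrite addrCA subrr addr0 -Mul submxK.
have ug' : g' \in unitmx.
  move: uM; rewrite ME !unitmxE det_mulmx det_lblock det_ublock !det1 !mul1r unitrM.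
  by case/andP.
have [T' [K' [L' [U' [[uT' KL' gT' K'C L'C] [U'0 U'C U'z]]]]]] := IH g' ug'.
pose T : 'M[int]_(1 + d) := (T1 : 'M[int]_(1 + d)) *m block_mx 1%:M 0 0 T'.
pose K : 'M[R]_(1 + d) := P *m block_mx 1%:M 0 c K'.
pose L : 'M[R]_(1 + d) := block_mx 1%:M 0 (- (L' *m c)) L' *m P.
pose U : 'M[R]_(1 + d) := block_mx be%:M (r *m toR T') 0 U'.
have Uul i j : U (lshift d i) (lshift d j) = be.
  by rewrite /U block_mxEul (ord1 i) (ord1 j) mxE eqxx.
have Udl i j : U (rshift 1 i) (lshift d j) = 0 by rewrite /U block_mxEdl mxE.
have Udr i j : U (rshift 1 i) (rshift 1 j) = U' i j by rewrite /U block_mxEdr.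
exists T, K, L, U; split; split.
- have bu : (block_mx 1%:M 0 0 T' : 'M[int]_(1 + d)) \in unitmx.
    by rewrite unitmxE det_lblock det1 mul1r -unitmxE.
  by rewrite /T unitmx_mul; apply/andP.
- rewrite /K /L -mulmxA [block_mx _ _ c _ *m _]mulmxA mulmx_block
    !mul1mx !mul0mx ?mulmx0 !addr0 KL'.
  rewrite mulmx1 mulmxN [K' *m _]mulmxA KL' mul1mx subrr add0r.
  by rewrite -scalar_mx_block mul1mx PP.
- have -> : g *m toR T = P *m M *m block_mx 1%:M 0 0 (toR T').
    rewrite /M mulmxA PP mul1mx /T map_mxM -mulmxA; congr (_ *m (_ *m _)).
    by rewrite map_block_mx map_mx1 !map_mx0.
  rewrite ME /K -!mulmxA; congr (_ *m _).
  have e : block_mx 1%:M 0 c K' *m U = block_mx be%:M (r *m toR T')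
      (c *m be%:M) (c *m (r *m toR T') + K' *m U').
    by rewrite /U mulmx_block !(mul1mx, mul0mx, mulmx0, addr0, mulmx1, add0r).
  apply: etrans (esym e); rewrite !mulmx_block.
  by rewrite !(mul1mx, mul0mx, mulmx0, addr0, mulmx1, add0r) gT'.
- move=> i j; rewrite /K /P -xrowE mxE; apply: le_trans C1'.
  case: (@split_ordP 1 d (tperm 0 i0 i)) => i' ->; case: (@split_ordP 1 d j) => j' ->.
  + by rewrite block_mxEul mxE normr_nat; apply: le_trans C1; rewrite lern1 leq_b1.
  + by rewrite block_mxEur mxE normr0.
  + by rewrite block_mxEdl; apply: le_trans C1.
  + by rewrite block_mxEdr.
- move=> i j; rewrite /L /P -xcolE mxE.
  case: (@split_ordP 1 d i) => i' ->; case: (@split_ordP 1 d (tperm 0 i0 j)) => j' ->.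
  + rewrite block_mxEul mxE normr_nat; apply: le_trans C1'; apply: le_trans C1.
    by rewrite lern1 leq_b1.
  + by rewrite block_mxEur mxE normr0 (le_trans _ C1').
  + rewrite block_mxEdl mxE normrN mxE; apply: le_trans (ler_norm_sum _ _ _) _.
    apply: le_trans (_ : \sum_(k < d) C <= _).
      by apply: ler_sum => l _; rewrite normrM -[leRHS]mulr1 ler_pM.
    rewrite sumr_const card_ord -[_ *+ _]mulr_natl ler_wpM2r // -[leLHS]mul1r.
    by rewrite ler_pM // ?ler1n // ler_nat.
  + by rewrite block_mxEdr (le_trans _ C1').
- move=> i j.
  case: (@split_ordP 1 d i) => i' ->; case: (@split_ordP 1 d j) => j' ->.
  + by rewrite (ord1 i') (ord1 j').
  + by rewrite (ord1 i').
  + by rewrite Udl.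
  + by rewrite Udr => /U'0.
- move=> i j.
  case: (@split_ordP 1 d i) => i' ->; case: (@split_ordP 1 d j) => j' ->.
  + rewrite !Uul => _; rewrite ler_peMl //.
    exact: le_trans C1'.
  + rewrite Uul Udr => _.
    (* A short vector of the projected lattice lifts to a vector of sup-norm at most
       |be| / 2 + mu, which the almost minimality of b compares with |be|. *)
    have d0 : (0 < d)%N by apply: leq_ltn_trans (ltn_ord j').
    have [z' z'0 z'U] := U'z (Ordinal d0) erefl.
    have U0j := U'C (Ordinal d0) j' (leq0n _).
    suff : `|be| <= 6 * `|U' (Ordinal d0) (Ordinal d0)|.
      move=> h; apply: le_trans h _; rewrite -!mulrA ler_pM2l //.
      by apply: le_trans U0j _; rewrite ler_peMl ?mulr_ge0 // ler1n.
    move: z'U; set mu := `|U' _ _| => z'U; have mu0 : 0 <= mu by apply: normr_ge0.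
    (* The multiple of [b] to subtract is chosen by rounding, which leaves a pivot coordinate [y] of
       size at most half of [be]. *)
    have [a] := round_half ((r *m toR z') 0 0 / be).
    set y := (r *m toR z') 0 0 - be * a%:~R => ya.
    have yb : `|y| <= `|be| / 2.
      move: ya; rewrite -(ler_pM2r (_ : 0 < `|be|)) ?normr_gt0 // -normrM.
      by rewrite mulrBl divfK // [a%:~R * be]mulrC -/y mul1r [_^-1 * _]mulrC.
    pose w : 'cV[int]_(1 + d) := col_mx (- a)%:M z'.
    pose zz : 'cV[int]_(1 + d) := (T1 : 'M[int]_(1 + d)) *m w.
    have zz0 : zz != 0.
      apply: contra z'0 => /eqP E; have : w = 0.
        by rewrite -[w](mulKmx uT1) -/zz E mulmx0.
      by rewrite -col_mx0 => /eq_col_mx[_ ->].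
    have Mw : M *m toR w = col_mx y%:M (c *m y%:M + g' *m toR z').
      rewrite ME -mulmxA /w map_col_mx !mul_block_col !mul1mx !mul0mx ?addr0 add0r.
      suff -> : be%:M *m toR (- a)%:M + r *m toR z' = y%:M by [].
      rewrite [r *m _]mx11_scalar map_scalar_mx -scalar_mxM -raddfD /y; congr (_%:M).
      by rewrite /= rmorphN mulrN addrC.
    have gzz : sup_norm (g *m toR zz) <= `|be| / 2 + mu.
      apply: sup_norm_le => [|l]; first by apply: addr_ge0; [apply: divr_ge0 |].
      have -> : (g *m toR zz) l 0 = (M *m toR w) (tperm 0 i0 l) 0.
        have -> : g *m toR zz = P *m (M *m toR w).
          by rewrite /M mulmxA [P *m (P *m _)]mulmxA PP mul1mx /zz map_mxM mulmxA.
        by rewrite /P -xrowE mxE.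
      rewrite Mw; case: (@split_ordP 1 d (tperm 0 i0 l)) => k' ->.
        by rewrite col_mxEu (ord1 k') mxE mulr1n (le_trans yb) // lerDl mu0.
      rewrite col_mxEd mul_mx_scalar [X in `|X|]mxE; apply: le_trans (ler_normD _ _) _.
      apply: lerD; last exact: le_trans (le_sup_norm _ _) z'U.
      by rewrite mxE normrM; apply: le_trans yb; rewrite -[leRHS]mulr1 ler_wpM2l.
    (* This reads |be| <= 3/2 (|be| / 2 + mu); the coefficient 3/4 of |be| is below 1, and solving
       gives the factor 6. *)
    have := le_trans (le_sup_norm b i0) (bmin _ zz0); rewrite -/be.
    by move: gzz; lra.
  + by rewrite (ord1 j').
  + rewrite !Udr leq_add2l => /U'C h; apply: le_trans h _.
    by rewrite ler_wpM2r.
- move=> i i00; exists (col 0 T1) => //; rewrite -/b.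
  have -> : i = lshift d (0 : 'I_1) by apply/val_inj.
  by rewrite Uul sup_norm_le.
Qed.

End Reduction.

(** * From the p-th compound to the next one *)

Section CompoundStep.
Import mathcomp.boot.fintype mathcomp.boot.finset.
Context {R : realType}.

Local Notation toR := (map_mx (intr : int -> R)).

Lemma det_bound d (A : 'M[R]_d) M : (forall i j, `|A i j| <= M) ->
  `|\det A| <= #|{perm 'I_d}|%:R * M ^+ d.
Proof.
move=> AM; rewrite /determinant; apply: le_trans (ler_norm_sum _ _ _) _.
rewrite mulr_natl -sumr_const; apply: ler_sum => s _.
rewrite normrM normrX normrN1 expr1n mul1r normr_prod.
rewrite -[in leRHS](card_ord d) -prodr_const.
by apply: ler_prod => i _; rewrite normr_ge0 AM.
Qed.

Definition initial_set d p : {set 'I_d} := [set i : 'I_d | (i < p)%N].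

Lemma card_initial_set d p : (p <= d)%N -> #|initial_set d p| = p.
Proof.
by move=> pd; rewrite cardsE -sum1_card (big_ord_narrow pd) sum1_card card_ord.
Qed.

Lemma cardsD_eq (T : finType) (A B : {set T}) : #|A| = #|B| -> #|A :\: B| = #|B :\: A|.
Proof.
by move=> AB; apply/eqP; rewrite -(eqn_add2l #|A :&: B|) cardsID setIC cardsID AB.
Qed.

(** Outside the common part, elements below p face equally many elements that are at least p. By
    minimality, [ext_basis_triangular] applies to the initial set at every K of the same size. *)
Lemma weight_initial_set d p (K : {set 'I_d}) : (p <= d)%N -> #|K| = p ->
  (weight val (initial_set d p) <= weight val K)%N.
Proof.
move=> pd Kp; rewrite /weight (big_setID K) [leqRHS](big_setID (initial_set d p)) /=.
rewrite setIC leq_add2l.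
apply: (@leq_trans (#|initial_set d p :\: K| * p)).
  rewrite -sum_nat_const; apply: leq_sum => i; rewrite !inE => /andP[_]; exact: ltnW.
rewrite (cardsD_eq (etrans (card_initial_set pd) (esym Kp))) -sum_nat_const.
by apply: leq_sum => i; rewrite !inE -leqNgt => /andP[].
Qed.

Lemma map_int_unimodular d (T : 'M[int]_d) : T \in unitmx ->
  toR T *m toR (invmx T) = 1%:M.
Proof. by move=> uT; rewrite -map_mxM mulmxV // map_mx1. Qed.

Lemma det_map_unimodular d (T : 'M[int]_d) : T \in unitmx -> `|\det (toR T)| = 1.
Proof.
rewrite unitmxE det_map_mx => uT.
have /orP[/eqP->|/eqP->] : (\det T == 1) || (\det T == -1) by exact: uT.
  by rewrite rmorph1 normr1.
by rewrite rmorphN1 normrN1.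
Qed.

(** Exchange argument: the indices of S outside I are traded through the threshold [lam] for equally
    many of I outside S, at the cost of C^2 each and with at most d trades. *)
Lemma prod_initial_set_le d p (u : 'I_d -> R) C (lam : R) (I : {set 'I_d}) :
  (p <= d)%N -> #|I| = p -> 1 <= C -> (forall i, 0 <= u i) ->
  (forall i : 'I_d, (i < p)%N -> u i <= C * lam) ->
  (forall i : 'I_d, (p <= i)%N -> lam <= C * u i) -> 0 <= lam ->
  \prod_(i in initial_set d p) u i <= C ^+ (2 * d) * \prod_(i in I) u i.
Proof.
move=> pd Ip C1 u0 ul lu l0; have C0 : 0 <= C by apply: le_trans C1.
set S := initial_set d p.
rewrite (big_setID I) [in leRHS](big_setID S) /= [I :&: S]setIC mulrCA.
rewrite ler_wpM2l ?prodr_ge0 //; set c := #|S :\: I|.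
have cE : c = #|I :\: S| by apply: cardsD_eq; rewrite card_initial_set.
have h1 : \prod_(i in S :\: I) u i <= C ^+ c * lam ^+ c.
  rewrite -exprMn -prodr_const; apply: ler_prod => i.
  by rewrite !inE u0 => /andP[_ /ul].
have h2 : lam ^+ c <= C ^+ c * \prod_(i in I :\: S) u i.
  rewrite cE -!prodr_const -big_split /=; apply: ler_prod => i.
  by rewrite !inE -leqNgt l0 => /andP[/lu].
apply: le_trans h1 _; apply: le_trans (_ : C ^+ c * (C ^+ c * \prod_(i in I :\: S) u i) <= _).
  by rewrite ler_wpM2l ?exprn_ge0.
rewrite mulrA -exprD ler_wpM2r ?prodr_ge0 // ler_weXn2l // mul2n -addnn.
by apply: leq_add; rewrite -[leqRHS](card_ord d) max_card.
Qed.

(** The constant is uniform in [g], so it can later be absorbed while the scaling parameter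
    grows. *)
Lemma compound_step d p : (p < d)%N -> exists2 C : R, 0 < C &
  forall (g : 'M[R]_d) (Z : multivector R d) N, g \in unitmx ->
    int_multivector p Z -> Z != 0 -> (forall I, `|ext_map g Z I| <= N) ->
  exists (Z' : multivector R d) N',
    [/\ int_multivector p.+1 Z', Z' != 0, 0 <= N',
        (forall I, `|ext_map g Z' I| <= N') &
        N' ^+ (d - p) <= C * `|\det g| * N ^+ (d - p - 1)].
Proof.
move=> pd; have [C1 C11 red] := @basis_reduction R d.
have C10 : 0 < C1 by apply: lt_le_trans C11.
set C2 : R := #|{set 'I_d}|%:R * (1 + d%:R * C1) ^+ d.
have C20 : 0 < C2.
  rewrite mulr_gt0 // ?ltr0n; first by apply/card_gt0P; exists set0.
  by rewrite exprn_gt0 // ltr_pwDl // mulr_ge0 // ltW.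
set C3 : R := #|{perm 'I_d}|%:R * C1 ^+ d.
have C30 : 0 < C3.
  rewrite mulr_gt0 ?exprn_gt0 // ltr0n; by apply/card_gt0P; exists 1%g.
exists (C2 ^+ (d - p) * (C1 ^+ (2 * d) * C2) ^+ (d - p - 1) * C1 ^+ (d - p) * C3).
  apply: mulr_gt0 C30; apply: mulr_gt0; last exact: exprn_gt0.
  by apply: mulr_gt0; apply: exprn_gt0 => //; apply: mulr_gt0 => //; apply: exprn_gt0.
move=> g Z N gu Zi Z0 ZN.
have [T [K [L [U [[uT KL gT KC LC] [U0 UC _]]]]]] := red g gu.
have [uK uL] := mulmx1_unit KL.
have LK : L *m K = 1%:M by apply: mulmx1C.
(* These are the coordinates of Z in the reduced basis, still integers since [T] is unimodular. *)
pose Z1 := ext_map (toR (invmx T)) Z.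
have intT (A : 'M[int]_d) i j : toR A i j \is a Num.int by rewrite mxE intr_int.
have Z1i : int_multivector p Z1 by apply: ext_map_int.
have TT := map_int_unimodular uT.
have [uTr uTi] := mulmx1_unit TT.
have Z10 : Z1 != 0 by rewrite ext_map_eq0.
have UZ1 : ext_map U Z1 = ext_map L (ext_map g Z).
  rewrite -[Z in RHS]ext_map_id -TT -ext_map_comp -/Z1 !ext_map_comp.
  by rewrite -[L *m g *m _]mulmxA gT [L *m (K *m _)]mulmxA LK mul1mx.
have U_tri i j : U i j != 0 -> i = j \/ (val i < val j)%N.
  move=> Uij; have [|/U0 E|/val_inj] := ltngtP (val i) (val j); [by right| |by left].
  by rewrite E eqxx in Uij.
have [I0 ZI0] : exists I, Z1 I != 0.
  apply/existsP; rewrite -negb_forall; apply: contra Z10 => /forallP h.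
  by apply/eqP/ffunP => I; rewrite [RHS]ffunE; apply/eqP.
(* At a support index of maximal weight the image under [U] is a nonzero integer times a product of
   p diagonal entries, so no cancellation can make it small. *)
have [I /= ZI Imax] :=
  @arg_maxnP _ I0 (fun I => Z1 I != 0) (fun I : {set 'I_d} => weight val I) ZI0.
have Ip : #|I| = p by apply/eqP; apply: contraNT ZI => /(proj2 (Z1i I)) ->.
pose u i := `|U i i|; have u0 i : 0 <= u i by apply: normr_ge0.
have hI : \prod_(i in I) u i <= C2 * N.
  have := ext_map_bound (ltW C10) LC ZN I; rewrite -UZ1.
  rewrite (ext_map_triangular U_tri) // normrM normr_prod; apply: le_trans.
  apply: ler_peMl; first by apply: prodr_ge0 => i _; apply: normr_ge0.
  by apply: norm_intr_ge1 ZI; apply: (proj1 (Z1i I)).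
pose q := Ordinal pd; pose S := initial_set d p; set pi := \prod_(i in S) u i.
have pi0 : 0 <= pi by apply: prodr_ge0 => i _; apply: u0.
have hpi : pi <= C1 ^+ (2 * d) * C2 * N.
  apply: le_trans (_ : C1 ^+ (2 * d) * \prod_(i in I) u i <= _); last first.
    by rewrite -mulrA ler_wpM2l // exprn_ge0 // ltW.
  apply: (@prod_initial_set_le _ _ _ _ (u q)) => //; first exact: ltnW.
  - by move=> i iq; apply: UC; apply: ltnW.
  - by move=> i iq; apply: UC.
(* The d - p diagonal entries from [q] on are at least [u q / C1] each, and with [pi] they make up
   the determinant of [U]. *)
have hdet : pi * u q ^+ (d - p) <= C1 ^+ (d - p) * (C3 * `|\det g|).
  apply: le_trans (_ : C1 ^+ (d - p) * \prod_i u i <= _).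
    rewrite [X in _ <= _ * X](bigID (fun i => i \in S)) /= mulrCA ler_wpM2l //.
    have cS : #|[pred i | i \notin S]| = (d - p)%N.
      rewrite -[in RHS](card_ord d) -(card_initial_set (ltnW pd)) -/S -(cardC (mem S)) addKn.
      by apply: eq_card.
    rewrite -cS -!prodr_const -big_split /=; apply: ler_prod => i.
    by rewrite !inE -leqNgt u0 => pi_le; apply: (UC q i).
  rewrite ler_wpM2l ?exprn_ge0 ?(ltW C10) // /u -normr_prod.
  have <- : \det U = \prod_i U i i.
    rewrite -det_tr det_trig; first by apply: eq_bigr => i _; rewrite mxE.
    by apply/is_trig_mxP => i j ij; rewrite mxE U0.
  have -> : U = L *m (g *m toR T) by rewrite gT mulmxA LK mul1mx.
  rewrite !det_mulmx !normrM det_map_unimodular // mulr1 ler_wpM2r //.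
  exact: det_bound.
pose S' := initial_set d p.+1.
have cS' : #|S'| = p.+1 by apply: card_initial_set.
have S'E : S' = q |: S.
  by apply/setP => i; rewrite !inE ltnS leq_eqVlt -val_eqE.
have qS : q \notin S by rewrite inE ltnn.
(* The wedge of the first p + 1 reduced basis vectors: since [S'] has least weight, its image in the
   triangular coordinates has the single entry [pi * u q] up to sign. *)
exists (ext_basis (toR T) S'), (C2 * (pi * u q)); split.
- by rewrite -cS'; apply: ext_basis_int_multivector.
- rewrite -[toR T]mulmx1 -ext_map_basis ext_map_eq0 //.
  apply/eqP => /ffunP/(_ S'); rewrite ffunE (@ext_basis_triangular _ _ _ val) //.
    rewrite eqxx mul1r big1 => [/eqP|i _]; first by rewrite oner_eq0.
    by rewrite mxE eqxx.
  by move=> i j; rewrite mxE; case: (eqVneq i j) => [->|_]; [left|rewrite eqxx].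
- by apply: mulr_ge0; [exact: ltW | apply: mulr_ge0].
- move=> J; rewrite ext_map_basis gT -ext_map_basis.
  apply: ext_map_bound (ltW C10) KC _ J => J.
  have [cJ|cJ] := eqVneq #|J| #|S'|; last first.
    by rewrite ext_basis_grade // normr0 mulr_ge0.
  rewrite (ext_basis_triangular U_tri); last first.
    by apply: weight_initial_set; rewrite // cJ.
  case: eqP => _; last by rewrite mul0r normr0 mulr_ge0.
  by rewrite mul1r normr_prod S'E big_setU1 // mulrC.
have N0 : 0 <= N by apply: le_trans (ZN set0).
clearbody C3 C2; rewrite exprMn -!mulrA ler_wpM2l ?exprn_ge0 ?(ltW C20) //.
rewrite exprMn.
(* [hpi] is used for d - p - 1 of the factors [pi]; the last one goes with the power of [u q] into
   [hdet]. *)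
have -> : pi ^+ (d - p) = pi ^+ (d - p - 1) * pi.
  by rewrite -exprSr subn1 prednK // subn_gt0.
rewrite -mulrA; apply: le_trans (_ : (C1 ^+ (2 * d) * C2 * N) ^+ (d - p - 1) *
  (C1 ^+ (d - p) * (C3 * `|\det g|)) <= _).
  by apply: ler_pM; rewrite ?exprn_ge0 ?mulr_ge0 ?exprn_ge0 // lerXn2r // nnegrE ?(le_trans pi0).
by rewrite !exprMn le_eqVlt; apply/orP; left; apply/eqP; ring.
Qed.

End CompoundStep.

(** * Systems of inequalities as bounds on a compound *)

Section Systems.
Import mathcomp.boot.fintype mathcomp.boot.finset.
Context {R : realType} {m n : nat} (Theta : 'M[R]_(n, m)).

(** The first m columns are those of [ell_mx]; completing them by standard vectors gives determinant
    1 and an explicit inverse. *)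
Definition shear_mx : 'M[R]_(m + n) := block_mx 1%:M 0 Theta 1%:M.
Definition unshear_mx : 'M[R]_(m + n) := block_mx 1%:M 0 (- Theta) 1%:M.
Definition scale_mx (s : R) : 'M[R]_(m + n) :=
  diag_mx (\row_i (if (i < m)%N then s^-1 else 1)).
Definition flow_mx s := scale_mx s *m unshear_mx.

Definition first_part (I : {set 'I_(m + n)}) : {set 'I_m} := [set i | lshift n i \in I].

Lemma mul_unshear : unshear_mx *m shear_mx = 1%:M.
Proof.
rewrite /unshear_mx /shear_mx mulmx_block !(mul1mx, mul0mx, mulmx0, addr0, mulmx1, add0r).
by rewrite addNr -scalar_mx_block.
Qed.

Lemma prod_first_part (I : {set 'I_(m + n)}) (a : R) :
  \prod_(i in I) (if (i < m)%N then a else 1) = a ^+ #|first_part I|.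
Proof.
rewrite -prodr_const big_mkcond big_split_ord /= [X in _ * X]big1 ?mulr1.
  rewrite [RHS]big_mkcond /=; apply: eq_bigr => i _.
  by rewrite inE ltn_ord.
by move=> i _; rewrite ltnNge leq_addr /=; case: ifP.
Qed.

Lemma ext_map_flow s Z I :
  ext_map (flow_mx s) Z I = ext_map unshear_mx Z I * s^-1 ^+ #|first_part I|.
Proof.
rewrite -ext_map_comp ext_map_diag; last by move=> i j /negbTE ij; rewrite mxE ij mulr0n.
rewrite -prod_first_part; congr (_ * _); apply: eq_bigr => i _.
by rewrite !mxE eqxx mulr1n.
Qed.

Lemma det_flow s : \det (flow_mx s) = s^-1 ^+ m.
Proof.
rewrite det_mulmx det_lblock !det1 !mulr1 det_diag.
under eq_bigr => i _ do rewrite mxE.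
rewrite -big_mkcond /=.
have := prod_first_part setT s^-1; rewrite -[in LHS]big_mkcondr /=.
under eq_bigl => i do rewrite inE /=.
move=> ->; congr (_ ^+ _); rewrite -[RHS](card_ord m) -cardsT; congr #|pred_of_set _|.
by apply/setP => i; rewrite !inE.
Qed.

Lemma wedge_L_sigma (sigma : {set 'I_m}) Z :
  wedge (L_sigma Theta sigma) Z = fold_vec shear_mx (map (lshift n) (enum sigma)) Z.
Proof.
rewrite /L_sigma; elim: (enum sigma) => [|a l IH]; first by rewrite big_nil wedge1l.
rewrite big_cons -wedgeA IH /=; congr (wedge (mv_of_vec _) _).
by apply/colP => k; rewrite !mxE; case: (split k) => k'; rewrite !row_mxEl.
Qed.

(** [unshear_mx] sends the first m columns of [ell_mx] to standard vectors, so in these coordinates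
    wedging with [L_sigma] is a relabelling up to sign. *)
Lemma wedge_L_sigma_unshear (sigma : {set 'I_m}) Z K :
  `|ext_map unshear_mx (wedge (L_sigma Theta sigma) Z) K| =
  if lshift n @: sigma \subset K then `|ext_map unshear_mx Z (K :\: lshift n @: sigma)| else 0.
Proof.
rewrite wedge_L_sigma ext_map_fold_vec mul_unshear fold_vec_id; last first.
  by rewrite map_inj_uniq ?enum_uniq //; apply: lshift_inj.
have -> // : [set i in map (lshift n) (enum sigma)] = lshift n @: sigma.
apply/setP => k; rewrite inE; apply/mapP/imsetP => -[i].
  by rewrite mem_enum => ? ->; exists i.
by move=> ? ->; exists i; rewrite ?mem_enum.
Qed.

Lemma mv_norm_le (u : multivector R (m + n)) N : (forall I, `|u I| <= N) -> mv_norm u <= N.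
Proof. by move=> uN; apply: bigmax_le => //; apply: le_trans (uN set0). Qed.

Lemma le_mv_norm (u : multivector R (m + n)) I : `|u I| <= mv_norm u.
Proof. by rewrite /mv_norm (le_bigmax _ (fun I => `|u I|)). Qed.

Lemma ext_map_bounded d (g : 'M[R]_d) : exists2 C : R, 0 < C &
  forall (u : multivector R d) N, (forall K, `|u K| <= N) -> forall K, `|ext_map g u K| <= C * N.
Proof.
pose M : R := \sum_i \sum_j `|g i j|.
have M0 : 0 <= M by do 2!apply: sumr_ge0 => ? _.
have gM i j : `|g i j| <= M.
  rewrite /M (bigD1 i) //= (bigD1 j) //= -addrA lerDl addr_ge0 ?sumr_ge0 // => k _.
  exact: sumr_ge0.
exists (#|{set 'I_d}|%:R * (1 + d%:R * M) ^+ d); last by move=> u N; apply: ext_map_bound.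
rewrite mulr_gt0 // ?ltr0n; first by apply/card_gt0P; exists set0.
by rewrite exprn_gt0 // ltr_pwDl // mulr_ge0.
Qed.

(** Here t = s^x and 1 + gamma = 1/x, which makes the exponents of the system affine in x. *)
Lemma system_exponent (s x k k0 : R) : x != 0 ->
  (s `^ x) `^ (1 - (k - k0) * (1 + (x^-1 - 1))) = s `^ (x - (k - k0)).
Proof. by move=> x0; rewrite -powRrM; congr (_ `^ _); field. Qed.

Lemma k0_minn p : (k0 (m:=m) p)%:R = m%:R - (minn m p)%:R :> R.
Proof. by rewrite /k0 -natrB ?geq_minl //; congr (_%:R); lia. Qed.

(** A coordinate with j indices among the first m is controlled by the inequality for k = m - j,
    whose excess s^j is cancelled by the scaling. *)
Lemma flow_bound_of_system : exists2 C : R, 0 < C & forall p Z s x, 1 <= s -> 0 < x ->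
  (forall k : nat, (k <= m)%N ->
     \big[Num.max/0]_(sigma : {set 'I_m} | #|sigma| == k)
        mv_norm (wedge (L_sigma Theta sigma) Z)
     <= (s `^ x) `^ (1 - (k%:R - (k0 (m:=m) p)%:R) * (1 + (x^-1 - 1)))) ->
  forall I, `|ext_map (flow_mx s) Z I| <= C * s `^ (x - (minn m p)%:R).
Proof.
have [C C0 CP] := ext_map_bounded unshear_mx; exists C => // p Z s x s1 x0 sys I.
have s0 : 0 < s by apply: lt_le_trans s1.
(* Wedging with L_sigma for the complementary sigma isolates the coordinate I. *)
set j := #|first_part I|; pose sigma := ~: first_part I.
have cj : (j <= m)%N by rewrite -[leqRHS](card_ord m) max_card.
have cs : #|sigma| = (m - j)%N by rewrite cardsCs setCK card_ord.
have h : mv_norm (wedge (L_sigma Theta sigma) Z) <= s `^ (x - (minn m p)%:R + j%:R).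
  apply: le_trans (_ : \big[Num.max/0]_(sigma : {set 'I_m} | #|sigma| == (m - j)%N)
     mv_norm (wedge (L_sigma Theta sigma) Z) <= _).
    apply: (le_bigmax_cond _ (fun sigma : {set 'I_m} =>
      mv_norm (wedge (L_sigma Theta sigma) Z))).
    by rewrite cs.
  apply: le_trans (sys _ (leq_subr _ _)) _.
  rewrite system_exponent ?gt_eqF // (k0_minn p) (natrB _ cj).
  by rewrite le_eqVlt; apply/orP; left; apply/eqP; congr (_ `^ _); ring.
have := CP _ _ (fun K => le_trans (le_mv_norm _ K) h) (I :|: lshift n @: sigma).
rewrite wedge_L_sigma_unshear subsetUr.
have -> : (I :|: lshift n @: sigma) :\: lshift n @: sigma = I.
  rewrite setDUl setDv setU0; apply/setDidPl; rewrite disjoint_sym disjoints_subset.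
  by apply/subsetP => k /imsetP[i]; rewrite !inE => ? ->.
rewrite ext_map_flow normrM [`|s^-1 ^+ _|]ger0_norm; last by rewrite exprn_ge0 // invr_ge0 ltW.
move=> h'; apply: le_trans (_ : C * s `^ (x - (minn m p)%:R + j%:R) * s^-1 ^+ j <= _).
  by rewrite ler_wpM2r // exprn_ge0 // invr_ge0 ltW.
rewrite powRD; last by rewrite (gt_eqF s0) implybT.
rewrite powR_mulrn ?(ltW s0) // -!mulrA exprVn mulfV ?mulr1 //.
by rewrite expf_neq0 // gt_eqF.
Qed.

(** Removing [sigma] of size k leaves at most m - k indices among the first m, so undoing the
    scaling costs at most s^(m - k), as s >= 1. *)
Lemma system_of_flow_bound : exists2 c : R, 0 < c & forall p Z s x, 1 <= s -> 0 < x ->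
  (forall I, `|ext_map (flow_mx s) Z I| <= c * s `^ (x - (minn m p)%:R)) ->
  forall k : nat, (k <= m)%N ->
     \big[Num.max/0]_(sigma : {set 'I_m} | #|sigma| == k)
        mv_norm (wedge (L_sigma Theta sigma) Z)
     <= (s `^ x) `^ (1 - (k%:R - (k0 (m:=m) p)%:R) * (1 + (x^-1 - 1))).
Proof.
have [C C0 CP] := ext_map_bounded shear_mx; exists C^-1; first by rewrite invr_gt0.
move=> p Z s x s1 x0 hZ k km; have s0 : 0 < s by apply: lt_le_trans s1.
apply: bigmax_le => [|sigma /eqP sk]; first exact: powR_ge0.
rewrite system_exponent ?gt_eqF // (k0_minn p).
set N := s `^ _; apply: mv_norm_le => K.
rewrite -[wedge _ _]ext_map_id -(mulmx1C mul_unshear) -ext_map_comp.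
rewrite -[N](mulVKf (lt0r_neq0 C0)).
apply: CP => {}K; rewrite wedge_L_sigma_unshear.
case: ifP => sK; last by rewrite mulr_ge0 ?powR_ge0 // invr_ge0 ltW.
set J := K :\: _; set j := #|first_part J|.
have jm : (j + k <= m)%N.
  rewrite -sk -[leqRHS](card_ord m) -cardsUI (_ : _ :&: _ = set0) ?cards0 ?addn0 ?max_card //.
  apply/setP => i; rewrite !inE; apply/negbTE/negP => /andP[/andP[+ _] si].
  by rewrite imset_f.
have -> : ext_map unshear_mx Z J = ext_map (flow_mx s) Z J * s ^+ j.
  by rewrite ext_map_flow -mulrA -exprMn mulVf ?expr1n ?mulr1 // gt_eqF.
rewrite normrM [X in _ * X]ger0_norm; last by rewrite exprn_ge0 ?(ltW s0).
apply: le_trans (_ : C^-1 * s `^ (x - (minn m p)%:R) * s ^+ j <= _).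
  by rewrite ler_wpM2r // exprn_ge0 // (ltW s0).
rewrite -mulrA ler_wpM2l ?invr_ge0 ?(ltW C0) // -powR_mulrn ?(ltW s0) // -powRD; last first.
  by rewrite (gt_eqF s0) implybT.
rewrite ler_powR //; have : j%:R + k%:R <= m%:R :> R by rewrite -natrD ler_nat.
by lra.
Qed.

End Systems.

(** * Exponents *)

Section Exponents.
Context {R : realType} {m n : nat} (Theta : 'M[R]_(n, m)).

Definition admissible p (gamma : R) :=
  forall T : R, exists2 t : R, T < t & system_solvable Theta p gamma t.

Lemma admissible_le p gamma : admissible p gamma ->
  (gamma%:E <= regular_exponent Theta p)%E.
Proof. by move=> h; apply: ereal_sup_ubound; exists gamma. Qed.

Lemma powR_unbounded (a B : R) : 0 < a -> exists2 t : R, 1 < t & B < t `^ a.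
Proof.
move=> a0; pose t : R := (2 + `|B|) `^ a^-1.
have t1 : 1 < t.
  have b0 := normr_ge0 B; rewrite /t -[ltLHS]/((fun=> 1) a^-1) -powR1.
  by apply: gt0_ltr_powR; rewrite ?nnegrE ?invr_gt0 //; lra.
exists t => //; rewrite /t -powRrM mulVf ?gt_eqF // powRr1; last first.
  by have := normr_ge0 B; lra.
by have := ler_norm B; lra.
Qed.

(** The strict inequality leaves a positive power of s, which absorbs all constants for large t. The
    term n appears for p < m because [minn m p] then grows by 1 with p. *)
Lemma admissible_step p x x' : (p < m + n)%N -> 0 < x -> 0 < x' ->
  admissible p (x^-1 - 1) ->
  (m + n - p - 1)%:R * x + (if (p < m)%N then n%:R else 0) < (m + n - p)%:R * x' ->
  admissible p.+1 (x'^-1 - 1).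
Proof.
move=> pd x0 x'0 adm xx' T; set e := (m + n - p - 1)%N in xx' *.
have eE : (m + n - p)%N = e.+1 by rewrite /e; lia.
have [C C0 fwd] := flow_bound_of_system Theta.
have [c c0 bwd] := system_of_flow_bound Theta.
have [C' C'0 step] := @compound_step R (m + n) p pd.
rewrite eE -/e in step xx'.
set a := x - (minn m p)%:R; set b := x' - (minn m p.+1)%:R.
(* The exponent to spare when [compound_step] is applied with N of order s^a and determinant s^(-m),
   for a target of order s^b. *)
pose del := e.+1%:R * b - e%:R * a + m%:R.
have del0 : 0 < del.
  suff : del = e.+1%:R * x' - (e%:R * x + (if (p < m)%N then n%:R else 0)) by lra.
  rewrite /del /a /b; case: (boolP (p < m)%N) => pm.
    have -> : minn m p = p by lia.
    have -> : minn m p.+1 = p.+1 by lia.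
    have : (m + n)%:R = (p + e.+1)%:R :> R by congr (_%:R); lia.
    rewrite !natrD -!natr1; set E : R := e%:R; set P : R := p%:R.
    move=> h; have -> : n%:R = P + (E + 1) - m%:R :> R by rewrite -h; ring.
    by ring.
  have -> : minn m p = m by lia.
  have -> : minn m p.+1 = m by lia.
  by rewrite -natr1; ring.
(* [t1] beats the constants, and [t2] makes the new parameter s^x' = t^(x'/x) exceed T. *)
have [t1 t11 ht1] := powR_unbounded (C' * C ^+ e / c ^+ e.+1) (divr_gt0 del0 x0).
have [t2 t21 ht2] := powR_unbounded T (divr_gt0 x'0 x0).
have [t tm [Z [Zi Z0 sys]]] := adm (Num.max t1 t2).
move: tm; rewrite gt_max => /andP[tt1 tt2].
have t1' : 1 < t by apply: lt_trans tt1.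
have t0 : 0 < t by lra.
pose s := t `^ x^-1.
have st y : t `^ (y / x) = s `^ y by rewrite /s -powRrM mulrC.
have s1 : 1 <= s by rewrite /s -(powRr0 t) ler_powR ?(ltW t1') // invr_ge0 ltW.
have s0 : 0 < s by apply: lt_le_trans s1.
have sx : t = s `^ x by rewrite -st mulfV ?gt_eqF // powRr1 // ltW.
rewrite sx in sys; clearbody s.
have [t00 t10 t20] : [/\ 0 <= t, 0 <= t1 & 0 <= t2] by split; lra.
have hZ := fwd p Z s x s1 x0 sys.
have us : flow_mx Theta s \in unitmx.
  by rewrite unitmxE det_flow unitfE expf_neq0 // invr_eq0 gt_eqF.
have [Z' [N' [Z'i Z'0 N'0 ZN' hN']]] := step _ _ _ us Zi Z0 hZ.
exists (s `^ x').
  apply: lt_trans ht2 _; rewrite -st.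
  by apply: gt0_ltr_powR; rewrite ?nnegrE ?divr_gt0.
exists Z'; split => //; apply: bwd => // I; apply: le_trans (ZN' I) _.
rewrite -(@ler_pXn2r _ e.+1) ?nnegrE //; last by rewrite mulr_ge0 ?powR_ge0 // ltW.
rewrite subn1 /= in hN'; apply: le_trans hN' _.
rewrite det_flow ger0_norm ?exprn_ge0 ?invr_ge0 ?(ltW s0) //.
have key : C' * C ^+ e <= c ^+ e.+1 * s `^ del.
  have : C' * C ^+ e / c ^+ e.+1 <= s `^ del.
    rewrite -st; apply: ltW; apply: lt_trans ht1 _.
    by apply: gt0_ltr_powR; rewrite ?nnegrE ?divr_gt0.
  by rewrite ler_pdivrMr ?exprn_gt0 // [s `^ del * _]mulrC.
have powE y k : (s `^ y) ^+ k = s `^ (k%:R * y).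
  by rewrite -powR_mulrn ?powR_ge0 // -powRrM mulrC.
rewrite !exprMn !powE.
have -> : s^-1 ^+ m = s `^ (- m%:R) by rewrite powRN powR_mulrn ?(ltW s0) // exprVn.
have -> : e.+1%:R * b = del + (e%:R * a - m%:R) by rewrite /del; ring.
have sn : s != 0 by rewrite gt_eqF.
rewrite [s `^ (del + _)]powRD ?sn ?implybT // [leRHS]mulrA.
rewrite [leLHS](_ : _ = C' * C ^+ e * s `^ (e%:R * a - m%:R)).
  by rewrite ler_wpM2r ?powR_ge0.
by rewrite powRD ?sn ?implybT //; ring.
Qed.

(** For gamma = -1 every right-hand side is t itself, so one fixed nonzero integer multivector
    serves all large t. In particular the exponent is never -oo. *)
Lemma regular_exponent_geN1 p : (p <= m + n)%N ->
  (-1%:E <= regular_exponent Theta p)%E.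
Proof.
move=> pd; apply: admissible_le => T.
pose Z : multivector R (m + n) := ext_basis 1%:M (initial_set (m + n) p).
pose M : R := \sum_(sigma : {set 'I_m}) mv_norm (wedge (L_sigma Theta sigma) Z).
have mv0 u : 0 <= mv_norm u :> R by apply: bigmax_ge_id.
exists (1 + `|T| + M).
  by have := ler_norm T; have : 0 <= M by [apply: sumr_ge0 => *; apply: mv0]; lra.
have M0 : 0 <= M by apply: sumr_ge0 => *; apply: mv0.
exists Z; split.
- rewrite -[p in int_multivector p](card_initial_set pd).
  by apply: ext_basis_int_multivector => i j; rewrite mxE; case: (_ == _).
- apply/eqP => /ffunP/(_ (initial_set (m + n) p)).
  rewrite [RHS]ffunE (@ext_basis_triangular _ _ _ val) //.
    rewrite eqxx mul1r big1 => [/eqP|i _]; first by rewrite oner_eq0.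
    by rewrite mxE eqxx.
  by move=> i j; rewrite mxE; case: (eqVneq i j) => [->|_]; [left|rewrite eqxx].
move=> k km; rewrite subrr mulr0 subr0 powRr1; last by rewrite !addr_ge0.
apply: bigmax_le => [|sigma _]; first by rewrite !addr_ge0.
apply: le_trans (_ : M <= _); last by have := normr_ge0 T; lra.
by rewrite /M (bigD1 sigma) //= lerDl sumr_ge0.
Qed.

(** Limit form of [admissible_step], as x' decreases to its bound; the supremum turns the strict
    inequality into a weak one. *)
Lemma exponent_step p gamma : (p < m + n - 1)%N -> admissible p gamma -> -1 < gamma ->
  (((m + n - p)%:R / ((m + n - p - 1)%:R / (1 + gamma) +
     (if (p < m)%N then n%:R else 0)))%:E <= 1 + regular_exponent Theta p.+1)%E.
Proof.
move=> pd adm g1; set e := (m + n - p - 1)%N.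
have eE : (m + n - p)%N = e.+1 by rewrite /e; lia.
have e0 : 0 < e%:R :> R by rewrite ltr0n /e; lia.
set w : R := if _ then _ else _; have w0 : 0 <= w by rewrite /w; case: ifP.
set x := (1 + gamma)^-1; have x0 : 0 < x by rewrite invr_gt0; lra.
have {}adm : admissible p (x^-1 - 1) by rewrite invrK addrC addKr.
rewrite eE; set D := e%:R * x + w; have D0 : 0 < D by rewrite ltr_wpDr // mulr_gt0.
have key x' : 0 < x' -> D < e.+1%:R * x' -> (x'^-1%:E <= 1 + regular_exponent Theta p.+1)%E.
  move=> x'0 hx'; have := @admissible_step p x x' _ x0 x'0 adm.
  rewrite -/e eE => /(_ _ hx')/admissible_le h.
  rewrite (_ : x'^-1 = 1 + (x'^-1 - 1)); last by ring.
  by rewrite EFinD leeD2l //; apply: h; lia.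
move: key; case: (regular_exponent Theta p.+1) (@regular_exponent_geN1 p.+1).
- move=> r _ key; rewrite -EFinD lee_fin; rewrite leNgt; apply/negP => lt.
  (* A single sample value of x' gives a positive lower bound, so 1 + r can be inverted. *)
  have r1 : 0 < 1 + r.
    have e1 : 0 < e.+1%:R :> R by rewrite ltr0n.
    have y0 : 0 < (D + 1) / e.+1%:R by rewrite divr_gt0 // addr_gt0.
    apply: lt_le_trans (_ : ((D + 1) / e.+1%:R)^-1 <= _); first by rewrite invr_gt0.
    have := key _ y0; rewrite -EFinD lee_fin; apply.
    by rewrite mulrC divfK ?gt_eqF // ltrDl.
  move: lt; rewrite ltr_pdivlMr // => lt.
  have e1 : 0 < e.+1%:R :> R by rewrite ltr0n.
  have uv : D / e.+1%:R < (1 + r)^-1.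
    by rewrite ltr_pdivrMr // mulrC ltr_pdivlMr // mulrC.
  have u0 : 0 < D / e.+1%:R by rewrite divr_gt0.
  (* An x' strictly between the bound and 1/(1 + r) would yield an admissible value above the
     supremum. *)
  pose y := (D / e.+1%:R + (1 + r)^-1) / 2.
  have [uy yv] := midf_lt uv; rewrite -/y in uy yv.
  have y0 : 0 < y by apply: lt_trans uy.
  have yD : D < e.+1%:R * y by rewrite mulrC -ltr_pdivrMr.
  have := key y y0 yD; rewrite -EFinD lee_fin leNgt => /negP; apply.
  by rewrite -[ltLHS]invrK ltf_pV2 ?posrE ?invr_gt0.
- by move=> _ _; rewrite addey // leey.
- by move=> /(_ _); rewrite leNgt ltNyr => h; have : false by apply: h; lia.
Qed.

End Exponents.

(** * Passage to the suprema, infinite exponents included *)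

Theorem theorem1 (R : realType) (m n : nat) (hm : (1 <= m)%N) (hn : (1 <= n)%N)
    (hd : (3 <= m + n)%N) (Theta : 'M[R]_(n, m))
    (p : nat) (hp1 : (1 <= p)%N) (hp2 : (p <= m + n - 2)%N) :
  ((m <= p)%N ->
    ((m + n - p - 1)%:R%:E * (1 + regular_exponent Theta p.+1)
       >= (m + n - p)%:R%:E * (1 + regular_exponent Theta p))%E) /\
  ((p <= m - 1)%N ->
    ((m + n - p - 1)%:R%:E * (1 + regular_exponent Theta p)^-1
       >= (m + n - p)%:R%:E * (1 + regular_exponent Theta p.+1)^-1
            - n%:R%:E)%E).
Proof.
have pd : (p < m + n - 1)%N by lia.
have geN1 : (-1%:E <= regular_exponent Theta p)%E by apply: regular_exponent_geN1; lia.
have geN1' : (-1%:E <= regular_exponent Theta p.+1)%E by apply: regular_exponent_geN1; lia.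
have step g := @exponent_step R m n Theta p g pd.
have le_sup := @ge_ereal_sup R
  [set gamma%:E | gamma in [set gamma | admissible Theta p gamma]]%classic.
set e := (m + n - p - 1)%N in step *.
have eE : (m + n - p)%N = e.+1 by rewrite /e; lia.
have e0 : 0 < e%:R :> R by rewrite ltr0n /e; lia.
have e1 : 0 < e.+1%:R :> R by rewrite ltr0n.
rewrite eE in step *; split => mp; move: step geN1'.
- rewrite ltnNge mp /=; case: (regular_exponent Theta p.+1) => [b'|_ _|]; last 2 first.
  + by rewrite addey // gt0_muley ?lte_fin // leey.
  + by move=> _; rewrite leNgt ltNyr.
  move=> step; rewrite lee_fin => b'N1.
  have ee1 : 0 <= e%:R / e.+1%:R :> R by rewrite divr_ge0.
  have b'0 : 0 <= 1 + b' by lra.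
  (* The inequality is solved for gamma before taking the supremum; values gamma <= -1 lie below the
     bound, which is at least -1. *)
  have : (regular_exponent Theta p <= (e%:R / e.+1%:R * (1 + b') - 1)%:E)%E.
    apply: le_sup => _ [g gadm <-]; rewrite lee_fin.
    have [g1|g1] := ltP (-1) g; last first.
      by apply: le_trans g1 _; rewrite lerBrDr addNr mulr_ge0.
    have g10 : 0 < 1 + g by lra.
    have := step g gadm g1; rewrite addr0 -EFinD lee_fin invf_div => h.
    have {}h : (1 + g) <= e%:R / e.+1%:R * (1 + b').
      apply: le_trans (_ : e%:R / e.+1%:R * (e.+1%:R * ((1 + g) / e%:R)) <= _).
        by rewrite le_eqVlt; apply/orP; left; apply/eqP; field; rewrite ?gt_eqF.
      by rewrite ler_wpM2l.
    by rewrite lerBrDl.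
  case: (regular_exponent Theta p) geN1 => [b|//|//] _; rewrite lee_fin => h.
  rewrite -!EFinD -!EFinM lee_fin.
  apply: le_trans (_ : e.+1%:R * (e%:R / e.+1%:R * (1 + b')) <= _).
    by rewrite ler_pM2l // -lerBrDl.
  by rewrite mulrA [e.+1%:R * (_ / _)]mulrC divfK ?gt_eqF.
- have -> : (p < m)%N by lia.
  (* The inverse of 0 in the extended reals is +oo. *)
  have [BN1|BN1] := eqVneq (regular_exponent Theta p) (-1%:E)%E.
    move=> _ _; rewrite BN1 -EFinN -EFinD subrr inve0 gt0_muley ?lte_fin // leey.
    by [].
  (* Applied to this [g0], the step forces 1 + b' > 0, so that its inverse is the ordinary one. *)
  have [g0 g0adm g01] : exists2 g, admissible Theta p g & -1 < g.
    apply: contrapT => h; case/eqP: BN1; apply/eqP; rewrite eq_le geN1 andbT.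
    apply: le_sup => _ [g gadm <-]; rewrite lee_fin leNgt; apply/negP => g1.
    by apply: h; exists g.
  have B1 : (0 <= (1 + regular_exponent Theta p)^-1)%E.
    by rewrite inve_ge0 -[leLHS](subee (_ : 1%E \is a fin_num)) // leeD2l.
  have eB0 : (0 <= e%:R%:E * (1 + regular_exponent Theta p)^-1)%E.
    by rewrite mule_ge0 // lee_fin ltW.
  case: (regular_exponent Theta p.+1) => [b'|_ _|]; last 2 first.
  (* The inverse of +oo is 0, so the right-hand side is -n. *)
  + rewrite addey // invey mule0 add0e; apply: le_trans eB0.
    by rewrite -EFinN lee_fin oppr_le0.
  + by move=> _; rewrite leNgt ltNyr.
  move=> step _; have n0 : 0 <= n%:R :> R by [].
  have D0 (g : R) : -1 < g -> 0 < e%:R / (1 + g) + n%:R.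
    by move=> g1; rewrite ltr_wpDr // divr_gt0 //; lra.
  have b'1 : 0 < 1 + b'.
    have := step _ g0adm g01; rewrite -EFinD lee_fin; apply: lt_le_trans.
    by rewrite divr_gt0 // D0.
  rewrite -EFinD inver gt_eqF // -EFinM -EFinN -EFinD.
  (* If v <= 0, nonnegativity of the left-hand side suffices; otherwise dividing by v gives a finite
     bound for the exponent at p. *)
  set v := _ - _; have [v0|v0] := leP v 0.
    by apply: le_trans eB0; rewrite lee_fin.
  have : (regular_exponent Theta p <= (e%:R / v - 1)%:E)%E.
    apply: le_sup => _ [g gadm <-]; rewrite lee_fin.
    have [g1|g1] := ltP (-1) g; last first.
      by apply: le_trans g1 _; rewrite lerBrDr addNr divr_ge0 // ltW.
    have g10 : 0 < 1 + g by lra.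
    have := step g gadm g1; rewrite -EFinD lee_fin ler_pdivrMr ?D0 // mulrC.
    rewrite -ler_pdivrMr // -lerBlDr -/v ler_pdivlMr // mulrC -ler_pdivlMr //.
    by rewrite lerBrDl.
  case: (regular_exponent Theta p) geN1 BN1 => [b|//|//]; rewrite lee_fin => b1 bN1 hb.
  have b10 : 0 < 1 + b.
    by rewrite -ltrBlDl sub0r lt_neqAle b1 andbT eq_sym; apply: contra bN1 => /eqP ->.
  rewrite -EFinD inver gt_eqF // -EFinM lee_fin.
  rewrite ler_pdivlMr // mulrC -ler_pdivlMr // -lerBrDl; exact: hb.
Qed.
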